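(* Let $-\infty<a<x<b<\infty$. (a) Let $\omega$ be a complex number with positive imaginary part. Let $f:\mathbb{R}\to\mathbb{R}$ be such that $f\in L^1((-\infty,b])$ and $f$ is regulated on $[-\infty,b]$. Then $$\frac{f(x-)+f(x+)}{2}=\int_{-\infty}^{\infty}H(x-t)e^{i\omega(x-t)}\,[df(t)-i\omega f(t)\,dt].$$ (b) Let $\omega$ be any complex number. Let $f$ be a real-valued function that is regulated on $[a,b]$. Then $$\frac{f(x-)+f(x+)}{2}=\int_a^b H(x-t)e^{i\omega(x-t)}\,[df(t)-i\omega f(t)\,dt]+f(a)e^{i\omega(x-a)}.$$
   Context: $H$ is the Heaviside step function: $H(u)=1$ for $u>0$, $H(0)=1/2$, $H(u)=0$ for $u<0$. The one-sided limits of $f$ at $x$ are denoted $f(x-)$ and $f(x+)$. Regulated functions: for $-\infty\le a<b\le\infty$, a function $f$ is regulated on $[a,b]$ if $f(x-)=\lim_{t\to x^-}f(t)$ exists in $\mathbb{R}$ for every $x\in(a,b]$ and $f(y+)=\lim_{t\to y^+}f(t)$ exists in $\mathbb{R}$ for every $y\in[a,b)$; a function given on $(a,b)$ is extended to $[a,b]$ by these limits at the endpoints (in particular at $\pm\infty$ if these are endpoints). Henstock--Stieltjes integral: let $-\infty\le a<b\le\infty$. A tagged partition of $[a,b]$ is a finite collection $\{([x_{n-1},x_n],z_n)\}_{n=1}^N$ with $a=x_0<x_1<\dots<x_N=b$ and $z_n\in[x_{n-1},x_n]$. A gauge is a function $\gamma$ assigning to each $z\in[a,b]$ an open interval $\gamma(z)$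 in $[a,b]$ containing $z$, where intervals $[a,u)$, $(u,v)$, $(u,b]$ with $u,v\in(a,b)$ count as open (a two-point compactification if $a=-\infty$, $b=\infty$). The tagged partition is $\gamma$-fine if $[x_{n-1},x_n]\subset\gamma(z_n)$ for all $n$. For $\varphi,f:[a,b]\to\mathbb{R}$, the integral $\int_a^b\varphi\,df$ exists and equals $I\in\mathbb{R}$ if for every $\epsilon>0$ there is a gauge $\gamma$ such that $\left|\sum_{n=1}^N\varphi(z_n)[f(x_n)-f(x_{n-1})]-I\right|<\epsilon$ for every $\gamma$-fine tagged partition. For complex-valued $\varphi$, integrate real and imaginary parts. The notation $\int\varphi(t)[df(t)-i\omega f(t)\,dt]$ means $\int\varphi\,df-i\omega\int\varphi(t)f(t)\,dt$, where the first integral is a Henstock--Stieltjes integral and the second is a Lebesgue integral. In (a), the integrand $\varphi(t)=H(x-t)e^{i\omega(x-t)}$ is zero for $t>x$, so only the values of $f$ on $[-\infty,b]$ matter, and $\varphi$ is given its limiting value $0$ at $t=\pm\infty$. *)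

(* Defs.v *)
From HB Require Import structures.
From mathcomp Require Import all_boot all_order all_algebra.
From mathcomp Require Import complex.
From mathcomp Require Import all_classical all_reals all_analysis.

Set Implicit Arguments.
Unset Strict Implicit.
Unset Printing Implicit Defensive.

Import Order.TTheory GRing.Theory Num.Theory.
Import numFieldNormedType.Exports.

Local Open Scope classical_set_scope.
Local Open Scope ring_scope.

Definition heaviside (R : realType) (u : R) : R :=
  if 0 < u then 1 else if u == 0 then 2^-1 else 0.

Definition cexp (R : realType) (z : R[i]) : R[i] :=
  Complex (expR (complex.Re z) * cos (complex.Im z))
          (expR (complex.Re z) * sin (complex.Im z)).

Definition left_lim (R : realType) (f : R -> R) (x : R) : R :=
  lim (f t @[t --> x^'-]).

Definition right_lim (R : realType) (f : R -> R) (x : R) : R :=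
  lim (f t @[t --> x^'+]).

(* [cvg] is convergence in [R], so all the limits required here are finite. *)
Definition regulated (R : realType) (a b : \bar R) (f : R -> R) : Prop :=
  [/\ forall x : R, (a < x%:E <= b)%E -> cvg (f t @[t --> x^'-]),
      forall y : R, (a <= y%:E < b)%E -> cvg (f t @[t --> y^'+]),
      a = -oo%E -> cvg (f t @[t --> -oo]) &
      b = +oo%E -> cvg (f t @[t --> +oo])].

(* An infinite endpoint at which the limit does not exist receives an
   arbitrary real value (the default of [lim]). *)
Definition ext_by_limits (R : realType) (f : R -> R) (t : \bar R) : R :=
  match t with
  | r%:E => f r
  | +oo%E => lim (f u @[u --> +oo])
  | -oo%E => lim (f u @[u --> -oo])
  end.

(* Real and infinite endpoints are treated uniformly: [a, b] is an interval of
   \bar R, which is the two-point compactification when a = -oo and b = +oo. *)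
Definition open_interval_in (R : realType) (a b : \bar R) (U : set (\bar R)) :
    Prop :=
  exists u v : \bar R,
    [/\ (a < u < b)%E, (a < v < b)%E &
        [\/ U = [set t | (a <= t < u)%E],
            U = [set t | (u < t < v)%E] |
            U = [set t | (u < t <= b)%E]]].

Definition gauge_on (R : realType) (a b : \bar R)
    (gamma : \bar R -> set (\bar R)) : Prop :=
  forall z, (a <= z <= b)%E -> open_interval_in a b (gamma z) /\ gamma z z.

(* The intervals are [x n, x n.+1] with tag z n for n < N; the values of
   x beyond N and of z from N on are irrelevant. *)
Definition tagged_partition (R : realType) (a b : \bar R) (N : nat)
    (x z : nat -> \bar R) : Prop :=
  [/\ x 0%N = a, x N = b &
      forall n, (n < N)%N ->
        (x n < x n.+1)%E /\ (x n <= z n <= x n.+1)%E].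

Definition gauge_fine (R : realType) (gamma : \bar R -> set (\bar R)) (N : nat)
    (x z : nat -> \bar R) : Prop :=
  forall n, (n < N)%N ->
    [set t | (x n <= t <= x n.+1)%E] `<=` gamma (z n).

Definition stieltjes_sum (R : realType) (phi f : \bar R -> R) (N : nat)
    (x z : nat -> \bar R) : R :=
  \sum_(n < N) phi (z n) * (f (x n.+1) - f (x n)).

(* "The Henstock-Stieltjes integral of phi df over [a, b] exists and
   equals I." *)
Definition is_HS_integral (R : realType) (a b : \bar R) (phi f : \bar R -> R)
    (I : R) : Prop :=
  forall eps : R, 0 < eps ->
    exists2 gamma, gauge_on a b gamma &
      forall (N : nat) (x z : nat -> \bar R),
        tagged_partition a b N x z -> gauge_fine gamma N x z ->
        `| stieltjes_sum phi f N x z - I | < eps.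

Definition is_HS_integralC (R : realType) (a b : \bar R) (phi : \bar R -> R[i])
    (f : \bar R -> R) (I : R[i]) : Prop :=
  is_HS_integral a b (fun t => complex.Re (phi t)) f (complex.Re I) /\
  is_HS_integral a b (fun t => complex.Im (phi t)) f (complex.Im I).

Definition integrableC (R : realType) (D : set R) (g : R -> R[i]) : Prop :=
  (@lebesgue_measure R).-integrable D (EFin \o (fun t => complex.Re (g t))) /\
  (@lebesgue_measure R).-integrable D (EFin \o (fun t => complex.Im (g t))).

Definition integralC (R : realType) (D : set R) (g : R -> R[i]) : R[i] :=
  Complex (Rintegral (@lebesgue_measure R) D (fun t => complex.Re (g t)))
          (Rintegral (@lebesgue_measure R) D (fun t => complex.Im (g t))).

(* "The integral of phi(t) [df(t) - i omega f(t) dt] over [a, b] exists and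
   equals v": the df part is a Henstock-Stieltjes integral and the dt part a
   Lebesgue integral over the real points of [a, b]. *)
Definition is_mixed_integral (R : realType) (a b : \bar R) (omega : R[i])
    (phi : \bar R -> R[i]) (f : R -> R) (v : R[i]) : Prop :=
  let D := [set t : R | (a <= t%:E <= b)%E] in
  let g := fun t : R => phi t%:E * (f t)%:C%C in
  exists I : R[i],
    [/\ is_HS_integralC a b phi (ext_by_limits f) I,
        integrableC D g &
        v = I - 'i%C * omega * integralC D g].

(* The value 0 at -oo is the limit when Im omega > 0; at +oo it always is. *)
Definition heaviside_exp (R : realType) (omega : R[i]) (x : R) (t : \bar R) : R[i] :=
  match t with
  | r%:E => (heaviside (x - r))%:C%C * cexp ('i%C * omega * (x - r)%:C%C)
  | _ => 0
  end.

(* Main.v *)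
Require Import Defs.
From HB Require Import structures.
From mathcomp Require Import all_boot all_order all_algebra.
From mathcomp Require Import complex.
From mathcomp Require Import all_classical all_reals all_analysis.
From mathcomp Require Import measurable_realfun.
From mathcomp Require Import ring lra.

Import Order.TTheory GRing.Theory Num.Theory.
Import numFieldNormedType.Exports.

Local Open Scope classical_set_scope.
Local Open Scope ring_scope.

(** The identity is integration by parts for phi df, where phi(t) is
    H(x - t) psi(t) and psi is a smooth function, namely the real or the
    imaginary part of exp(i omega (x - t)). Since psi' = - i omega psi in the
    complex notation, the term in dt on the right-hand side of the theorem is
    the integral of psi' f over (-oo, x] or [a, x]; the average of
    the two one-sided limits is what the jump of phi at x, with the middle
    value 1/2 there, leaves as a boundary term.

    The Henstock-Stieltjes integral is computed by exhibiting a primitive G of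
    phi df. Left of x it is
      G(t) = psi(t) f(t) - (integral of psi' f up to t),
    and it takes the constant value
      psi(x) (f(x-) + f(x+)) / 2 - (integral of psi' f up to x)
    right of x. To be a primitive means that on a small interval [u, v] tagged
    by z in [u, v] the defect phi(z) (f(v) - f(u)) - (G(v) - G(u)) is at most
    eps (W(v) - W(u)), for a fixed bounded monotone W. Summing over a fine
    tagged partition then telescopes on both sides, which gives G(B) - G(A)
    ([is_HS_integral_of_primitive]). Only the intervals with u = z or v = z
    have to be examined, so each point z contributes a one-sided estimate:
    - at z < x, the integral of psi' f has one-sided derivatives
      psi'(z) f(z+) and psi'(z) f(z-) because f is regulated, and these cancel
      the first-order part of the increment of psi times f
      ([indefinite_integral_right], [indefinite_integral_left] and
      [product_increment_near]);
    - at z = x, the defect is a multiple of f(v) - f(x+) or f(u) - f(x-), up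
      to a term that tends to 0. It need not be small compared with the length
      of the interval, so W is given a jump at x;
    - at z = -oo, the same happens, because phi vanishes there and G tends to 0,
      by the decay of psi and by the integrability of psi' f.
    These estimates are put together in [is_HS_integral_heaviside_mul].

    In part (b) the integrability of f on [a, b] has to be derived: by
    compactness a regulated function is a uniform limit of bounded measurable
    functions ([regulated_approx]). The complex statement, for both parts at
    once, is [is_mixed_integral_heaviside_exp]. *)

(** * Primitives for the Henstock-Stieltjes integral *)

(** If the increments of [G] agree with those of [phi dF] up to an arbitrarily
    small multiple of the increments of [W], then the errors made on the
    intervals of a fine tagged partition add up, by telescoping, to a small
    multiple of [W B - W A]. A tag splits its interval in two, whence the
    hypotheses on intervals with the tag at an end. *)
Lemma is_HS_integral_of_primitive (R : realType) (A B : \bar R)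
    (phi F G W : \bar R -> R) : (A < B)%E ->
  (forall eps, 0 < eps -> forall z, (A <= z < B)%E ->
     exists2 w, (z < w < B)%E & forall v, (z < v < w)%E ->
       `|phi z * (F v - F z) - (G v - G z)| <= eps * (W v - W z)) ->
  (forall eps, 0 < eps -> forall z, (A < z <= B)%E ->
     exists2 w, (A < w < z)%E & forall u, (w < u < z)%E ->
       `|phi z * (F z - F u) - (G z - G u)| <= eps * (W z - W u)) ->
  is_HS_integral A B phi F (G B - G A).
Proof.
move=> AB right_est left_est eps eps0.
(* The added 1 keeps eps / c meaningful when W A = W B. *)
pose c := `|W B - W A| + 1.
have c0 : 0 < c by rewrite ltr_wpDl.
have e0 : 0 < eps / c by rewrite divr_gt0.
have local_gauge z : (A <= z <= B)%E -> exists U : set (\bar R),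
    [/\ open_interval_in A B U, U z &
     forall u v, U u -> U v -> (u <= z <= v)%E ->
       `|phi z * (F v - F u) - (G v - G u)| <= eps / c * (W v - W u)].
  move=> /andP[Az zB].
  have rightP : (z < B)%E -> exists2 w, (z < w < B)%E &
      forall v, (z <= v < w)%E ->
       `|phi z * (F v - F z) - (G v - G z)| <= eps / c * (W v - W z).
    move=> zB'; have [|w zwB wP] := right_est _ e0 z; first by rewrite Az.
    exists w => // v /andP[]; rewrite le_eqVlt => /predU1P[-> _|zv vw].
      by rewrite !subrr !mulr0 subrr normr0.
    by apply: wP; rewrite zv.
  have leftP : (A < z)%E -> exists2 w, (A < w < z)%E &
      forall u, (w < u <= z)%E ->
       `|phi z * (F z - F u) - (G z - G u)| <= eps / c * (W z - W u).
    move=> Az'; have [|w Awz wP] := left_est _ e0 z; first by rewrite Az'.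
    exists w => // u /andP[wu]; rewrite le_eqVlt => /predU1P[->|uz].
      by rewrite !subrr !mulr0 subrr normr0.
    by apply: wP; rewrite wu.
  move: Az; rewrite le_eqVlt => /predU1P[Az|Az].
    rewrite -Az in rightP *.
    have [w /andP[Aw wB] wP] := rightP AB.
    exists [set t | (A <= t < w)%E]; split => /=.
    - exists w, w; rewrite Aw wB; split => //; exact: Or31.
    - by rewrite lexx.
    - move=> u v /andP[Au uw] vI /andP[uA Av].
      have -> : u = A by apply/eqP; rewrite eq_le uA.
      exact: wP.
  move: zB; rewrite le_eqVlt => /predU1P[zB|zB].
    rewrite zB in leftP *.
    have [w /andP[Aw wB] wP] := leftP AB.
    exists [set t | (w < t <= B)%E]; split => /=.
    - exists w, w; rewrite Aw wB; split => //; exact: Or33.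
    - by rewrite wB lexx.
    - move=> u v uI /andP[wv vB] /andP[uB Bv].
      have -> : v = B by apply/eqP; rewrite eq_le vB.
      exact: wP.
  have [w1 /andP[Aw1 w1z] w1P] := leftP Az.
  have [w2 /andP[zw2 w2B] w2P] := rightP zB.
  exists [set t | (w1 < t < w2)%E]; split => /=.
  - exists w1, w2; rewrite Aw1 w2B (lt_trans w1z zB) (lt_trans Az zw2).
    by split => //; exact: Or32.
  - by rewrite w1z.
  - move=> u v /andP[w1u _] /andP[_ vw2] /andP[uz zv].
    have -> : phi z * (F v - F u) - (G v - G u) =
        (phi z * (F v - F z) - (G v - G z)) +
        (phi z * (F z - F u) - (G z - G u)) by ring.
    have -> : W v - W u = (W v - W z) + (W z - W u) by ring.
    rewrite [leRHS]mulrDr (le_trans (ler_normD _ _))// lerD//.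
      by apply: w2P; rewrite zv.
    by apply: w1P; rewrite w1u.
have /choice[gamma gammaP] : forall z, exists U : set (\bar R),
    (A <= z <= B)%E -> [/\ open_interval_in A B U, U z &
     forall u v, U u -> U v -> (u <= z <= v)%E ->
       `|phi z * (F v - F u) - (G v - G u)| <= eps / c * (W v - W u)].
  move=> z; have [zAB|] := boolP (A <= z <= B)%E.
    by have [U UP] := local_gauge z zAB; exists U.
  by exists setT.
exists gamma => [z /gammaP[]//|N x z [x0 xN xz] fine].
have xincr m n : (m <= n <= N)%N -> (x m <= x n)%E.
  move=> /andP[]; elim: n => [|n IH]; first by rewrite leqn0 => /eqP ->.
  rewrite leq_eqVlt => /predU1P[->//|mn nN].
  by rewrite (le_trans (IH mn (ltnW nN)))// ltW//; case: (xz _ nN).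
have term n : (n < N)%N ->
    `|phi (z n) * (F (x n.+1) - F (x n)) - (G (x n.+1) - G (x n))| <=
    eps / c * (W (x n.+1) - W (x n)).
  move=> nN; have [xx /[dup] xzx /andP[xz1 zx1]] := xz _ nN.
  have [|_ _] := gammaP (z n).
    apply/andP; split; first by rewrite -x0 (le_trans _ xz1)// xincr//= ltnW.
    by rewrite -xN (le_trans zx1)// xincr// nN leqnn.
  apply; rewrite ?xzx//; apply: fine => //=; rewrite lexx ?andbT//; exact: ltW.
have tele (f : \bar R -> R) : f B - f A = \sum_(n < N) (f (x n.+1) - f (x n)).
  rewrite -x0 -xN -(big_mkord xpredT (fun n => f (x n.+1) - f (x n))).
  by rewrite telescope_sumr.
rewrite /stieltjes_sum (tele G) -sumrB.
apply: (@le_lt_trans _ _ (eps / c * (W B - W A))).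
  rewrite (tele W) mulr_sumr (le_trans (ler_norm_sum _ _ _))//.
  by apply: ler_sum => n _; exact: term.
rewrite mulrAC ltr_pdivrMr// ltr_pM2l// /c.
by rewrite (le_lt_trans (ler_norm _))// ltrDl.
Qed.

(** * One-sided derivatives of indefinite integrals *)

Lemma is_derive_near (R : realType) (f : R -> R) (z d : R) :
  is_derive z 1 f d ->
  forall e : R, 0 < e -> \forall v \near z,
    `|f v - f z - d * (v - z)| <= e * `|v - z|.
Proof.
move=> [fz dfz] e e0.
have := cvg_toP fz dfz; move/cvgrPdist_le/(_ e e0).
rewrite near_withinE /= => /nbhs_ballP[r/= r0 rP].
near=> v; have [->|vz] := eqVneq v z.
  by rewrite !subrr mulr0 subrr !normr0 mulr0.
have vz0 : v - z != 0 by rewrite subr_eq0.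
have dist : `|v - z| < r -> `|d - (v - z)^-1 *: (f v - f z)| <= e.
  move=> vzr; have := rP (v - z).
  by rewrite /ball/= sub0r normrN scaler1 subrK; apply.
have -> : f v - f z - d * (v - z) = - (d - (v - z)^-1 *: (f v - f z)) * (v - z).
  rewrite /GRing.scale/=; field.
  exact: vz0.
rewrite normrM normrN; apply: ler_wpM2r => //; apply: dist.
rewrite distrC; near: v; exact: nbhsx_ballx.
Unshelve. all: by end_near. Qed.

Lemma Rintegral_approx_cst (R : realType) (g : R -> R) (u v l e : R) : u <= v ->
  (@lebesgue_measure R).-integrable `]u, v[ (EFin \o g) ->
  (forall t, u < t < v -> `|g t - l| <= e) ->
  `|\int[@lebesgue_measure R]_(t in `]u, v[) g t - l * (v - u)| <= e * (v - u).
Proof.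
move=> uv intg gl.
have muE : fine ((@lebesgue_measure R) `]u, v[) = v - u.
  rewrite lebesgue_measure_itv/= lte_fin; case: ifPn => //.
  rewrite -leNgt => vu; have -> : v = u by apply/eqP; rewrite eq_le uv vu.
  by rewrite subrr.
have intc c : (@lebesgue_measure R).-integrable `]u, v[ (EFin \o cst c).
  apply: measurable_bounded_integrable => //.
    by rewrite /= lebesgue_measure_itv/=; case: ifP => // _; rewrite ltry.
  by exists `|c|; split => // M cM t _; exact: ltW.
have cstE c : \int[@lebesgue_measure R]_(t in `]u, v[) c = c * (v - u).
  by rewrite Rintegral_cst// muE.
rewrite -(cstE l) -RintegralB//; last exact: intc.
rewrite -(cstE e).
have intgl : (@lebesgue_measure R).-integrable `]u, v[
    (EFin \o (fun t => g t - l)).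
  by apply: (integrableB _ intg (intc l)).
apply: le_trans (le_normr_Rintegral _ intgl) _ => //.
by apply: le_Rintegral => //; [exact: (integrable_norm intgl)|exact: (intc e)].
Qed.

(** The lower end is an interval bound, so that integrals from a real number and
    from -oo are treated together. *)
Definition indefinite_integral {R : realType} (l : itv_bound R) (g : R -> R)
    (t : R) : R :=
  \int[@lebesgue_measure R]_(s in [set` Interval l (BRight t)]) g s.

Lemma indefinite_integralB (R : realType) (l : itv_bound R) (x : R)
    (g : R -> R) (u v : R) :
  (@lebesgue_measure R).-integrable [set` Interval l (BRight x)] (EFin \o g) ->
  (l <= BRight u)%O -> u < v -> v <= x ->
  (@lebesgue_measure R).-integrable `]u, v[ (EFin \o g) /\
  indefinite_integral l g v - indefinite_integral l g u =
  \int[@lebesgue_measure R]_(s in `]u, v[) g s.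
Proof.
move=> intg lu uv vx.
have iv : (@lebesgue_measure R).-integrable
    [set` Interval l (BRight v)] (EFin \o g).
  by apply: integrableS intg => //; apply: subset_itvl; rewrite bnd_simp.
have iuv : (@lebesgue_measure R).-integrable `]u, v[ (EFin \o g).
  apply: integrableS iv => //; apply: subset_itv => //; by rewrite bnd_simp.
split=> //; rewrite /indefinite_integral Rintegral_itvB// ?bnd_simp ?ltW//.
by rewrite Rintegral_itv_bndo_bndc.
Qed.

(** The one-sided form of the fundamental theorem of calculus: a one-sided limit
    of the integrand is enough for the one-sided derivative. *)
Lemma indefinite_integral_right (R : realType) (l : itv_bound R) (x : R)
    (g : R -> R) (z c : R) :
  (@lebesgue_measure R).-integrable [set` Interval l (BRight x)] (EFin \o g) ->
  (l <= BRight z)%O -> z < x ->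
  g t @[t --> z^'+] --> c ->
  forall e : R, 0 < e -> \forall v \near z^'+,
    `|indefinite_integral l g v - indefinite_integral l g z - c * (v - z)|
      <= e * `|v - z|.
Proof.
set Phi := indefinite_integral l g.
move=> intg lz zx /cvgrPdist_le gc e e0.
have := gc e e0; rewrite near_withinE => /nbhs_ballP[r/= r0 rP].
near=> v; have zv : z < v by near: v; exact: nbhs_right_gt.
have vx : v <= x by near: v; exact: nbhs_right_le.
have vr : v < z + r by near: v; apply: nbhs_right_lt; rewrite ltrDl.
have [iv ->] := indefinite_integralB _ _ _ _ _ _ intg lz zv vx.
rewrite (gtr0_norm (_ : 0 < v - z)) ?subr_gt0//.
apply: Rintegral_approx_cst => // t /andP[zt tv].
rewrite distrC; apply: rP => //; rewrite /ball/= distrC gtr0_norm ?subr_gt0//.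
by rewrite ltrBlDl (lt_trans tv).
Unshelve. all: by end_near. Qed.

Lemma indefinite_integral_left (R : realType) (l : itv_bound R) (x : R)
    (g : R -> R) (z c : R) :
  (@lebesgue_measure R).-integrable [set` Interval l (BRight x)] (EFin \o g) ->
  (l < BLeft z)%O -> z <= x ->
  g t @[t --> z^'-] --> c ->
  forall e : R, 0 < e -> \forall v \near z^'-,
    `|indefinite_integral l g v - indefinite_integral l g z - c * (v - z)|
      <= e * `|v - z|.
Proof.
set Phi := indefinite_integral l g.
move=> intg lz zx /cvgrPdist_le gc e e0.
have lnear : \forall v \near z^'-, (l <= BRight v)%O.
  case: l lz {intg Phi} => [b y lz|[]// _]; last exact: nearW.
  have yz : y < z by case: b lz; rewrite bnd_simp.
  near=> v; have : y <= v by near: v; exact: nbhs_left_ge.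
  by case: b {lz}; rewrite bnd_simp.
have := gc e e0; rewrite near_withinE => /nbhs_ballP[r/= r0 rP].
near=> v; have vz : v < z by near: v; exact: nbhs_left_lt.
have vr : z - r < v by near: v; apply: nbhs_left_gt; rewrite ltrBlDr ltrDl.
have lv : (l <= BRight v)%O by near: v.
have [iv PhiE] := indefinite_integralB _ _ _ _ _ _ intg lv vz zx.
rewrite distrC (ltr0_norm (_ : v - z < 0)) ?subr_lt0// [in leRHS]opprB.
have -> : c * (v - z) - (Phi v - Phi z) = (Phi z - Phi v) - c * (z - v) by ring.
rewrite PhiE; apply: Rintegral_approx_cst => // t /andP[vt tz].
rewrite distrC; apply: rP => //; rewrite /ball/= gtr0_norm ?subr_gt0//.
by rewrite ltrBlDl -ltrBlDr (lt_trans vr).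
Unshelve. all: by end_near. Qed.

(** Dominated convergence, applied along the sequences that tend to -oo to the
    restrictions of [g]. *)
Lemma Rintegral_Ny_cvg0 (R : realType) (x : R) (g : R -> R) :
  (@lebesgue_measure R).-integrable `]-oo, x] (EFin \o g) ->
  \int[@lebesgue_measure R]_(s in `]-oo, t]) g s @[t --> -oo] --> 0.
Proof.
move=> intg; apply/cvg_ninftyP => u uNy.
have mg : measurable_fun `]-oo, x] g.
  by apply/measurable_EFinP; exact: measurable_int intg.
pose h n := g \_ `]-oo, u n].
have dc : (\int[@lebesgue_measure R]_(s in `]-oo, x]) (h n s)%:E)%E
    @[n --> \oo] --> 0%E.
  have [] // := @dominated_convergence _ _ _ (@lebesgue_measure R) `]-oo, x]
    _ (fun n => EFin \o h n) (cst 0%E) (abse \o (EFin \o g)).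
  - move=> n; apply/measurable_EFinP/measurable_restrict => //.
    exact: measurable_funS mg.
  - apply: aeW => t _ /=; apply: cvg_near_cst.
    move/cvgrNyPlt : uNy => /(_ t); apply: filterS => n unt.
    by rewrite /h patchE memNset//= in_itv/= leNgt unt.
  - exact: integrable_abse.
  - apply: aeW => t n _; rewrite /h/= patchE; case: ifP => // _.
    by rewrite normr0 lee_fin.
  - by move=> _ _; rewrite integral0.
move/fine_cvg : dc; apply: cvg_trans; apply: near_eq_cvg.
move/cvgrNyPlt : uNy => /(_ x); apply: filterS => n unx.
rewrite /= -/(Rintegral _ _ _) -Rintegral_mkcondr; congr Rintegral.
apply/seteqP; split => t /=; rewrite !in_itv/=; first by case.
by move=> tu; split => //; rewrite (le_trans tu)// ltW.
Qed.

(** * Integration by parts against a cut-off function *)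

(** These two lemmas pass from filters on the reals to the intervals of the
    extended reals in which gauges are described. *)
Lemma near_right_ereal (R : realType) (z : R) (B : \bar R) (P : \bar R -> Prop) :
  (z%:E < B)%E -> (\forall v \near z^'+, P v%:E) ->
  exists2 w, (z%:E < w < B)%E & forall v, (z%:E < v < w)%E -> P v.
Proof.
move=> zB; rewrite near_withinE => /nbhs_ballP[r/= r0 rP].
have nearB : \forall w \near z^'+, (w%:E < B)%E.
  case: B zB => [b|_|//]; last by apply: nearW => w; rewrite ltry.
  by rewrite lte_fin => zb; near=> w; rewrite lte_fin; near: w; exact: nbhs_right_lt.
have [w [[zw wr] wB]] : exists w, (z < w /\ w < z + r) /\ (w%:E < B)%E.
  apply: (@filter_ex _ z^'+); near=> w; split; last by near: w.
  by split => //; near: w; apply: nbhs_right_lt; rewrite ltrDl.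
exists w%:E; rewrite ?lte_fin ?zw ?wB// => -[v| |]/=; rewrite ?lte_fin.
- move=> /andP[zv vw]; apply: rP => //; rewrite /ball/= distrC gtr0_norm ?subr_gt0//.
  by rewrite ltrBlDl (lt_trans vw).
- by rewrite andbC ltNge leey.
- by [].
Unshelve. all: by end_near. Qed.

Lemma near_left_ereal (R : realType) (z : R) (A : \bar R) (P : \bar R -> Prop) :
  (A < z%:E)%E -> (\forall u \near z^'-, P u%:E) ->
  exists2 w, (A < w < z%:E)%E & forall u, (w < u < z%:E)%E -> P u.
Proof.
move=> Az; rewrite near_withinE => /nbhs_ballP[r/= r0 rP].
have nearA : \forall w \near z^'-, (A < w%:E)%E.
  case: A Az => [a|//|_]; last by apply: nearW => w; rewrite ltNyr.
  by rewrite lte_fin => az; near=> w; rewrite lte_fin; near: w; exact: nbhs_left_gt.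
have [w [[wz rw] Aw]] : exists w, (w < z /\ z - r < w) /\ (A < w%:E)%E.
  apply: (@filter_ex _ z^'-); near=> w; split; last by near: w.
  by split => //; near: w; apply: nbhs_left_gt; rewrite ltrBlDr ltrDl.
exists w%:E; rewrite ?lte_fin ?wz ?Aw// => -[u| |]/=; rewrite ?lte_fin.
- move=> /andP[wu uz]; apply: rP => //; rewrite /ball/= gtr0_norm ?subr_gt0//.
  by rewrite ltrBlDl -ltrBlDr (lt_trans rw).
- by rewrite andbC ltNge leey.
- by [].
Unshelve. all: by end_near. Qed.

(** With [d = psi'(z)] and [L] a one-sided limit of [f] at [z], both
    [(psi v - psi z) * f v] and [Phi v - Phi z] equal [d * L * (v - z)] up to a
    term negligible before [v - z]. *)
Lemma product_increment_near (R : realType) (F : set_system R) {FF : Filter F}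
    (psi f Phi : R -> R) (z d L : R) :
  (forall e, 0 < e -> \forall v \near F,
     `|psi v - psi z - d * (v - z)| <= e * `|v - z|) ->
  f t @[t --> F] --> L ->
  (forall e, 0 < e -> \forall v \near F,
     `|Phi v - Phi z - (d * L) * (v - z)| <= e * `|v - z|) ->
  forall e, 0 < e -> \forall v \near F,
    `|(psi v - psi z) * f v - (Phi v - Phi z)| <= e * `|v - z|.
Proof.
move=> psid fL Phid e e0.
pose e1 := e / 3 / (`|L| + 1); pose e2 := e / 3 / (`|d| + 1).
have [e10 e20] : 0 < e1 /\ 0 < e2 by split; rewrite !divr_gt0// ltr_wpDl.
have e1E : e / 3 = e1 * (`|L| + 1).
  by rewrite /e1 -[RHS]mulrA mulVf ?mulr1// gt_eqF// ltr_wpDl.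
have e2E : e / 3 = (`|d| + 1) * e2.
  by rewrite /e2 [RHS]mulrC -[RHS]mulrA mulVf ?mulr1// gt_eqF// ltr_wpDl.
have e30 : 0 < e / 3 by rewrite divr_gt0.
move/cvgrPdist_le : fL => fL.
near=> v.
have vL1 : `|L - f v| <= 1 by near: v; exact: fL.
have vL2 : `|L - f v| <= e2 by near: v; exact: fL.
have fv : `|f v| <= `|L| + 1.
  have -> : f v = L - (L - f v) by ring.
  by rewrite (le_trans (ler_normB _ _))// lerD2l.
have -> : (psi v - psi z) * f v - (Phi v - Phi z) =
  (psi v - psi z - d * (v - z)) * f v - d * (v - z) * (L - f v)
   - (Phi v - Phi z - (d * L) * (v - z)) by ring.
apply: le_trans (ler_normB _ _) _; have -> : e = e / 3 + e / 3 + e / 3 by field.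
rewrite 2!(mulrDl _ _ `|v - z|) lerD//; last by near: v; exact: Phid.
apply: le_trans (ler_normB _ _) _; rewrite lerD// !normrM.
  by rewrite e1E mulrAC ler_pM//; near: v; exact: psid.
rewrite mulrAC ler_wpM2r//.
by rewrite e2E ler_pM// lerDl.
Unshelve. all: by end_near. Qed.

Definition heaviside_mul {R : realType} (x : R) (psi : R -> R) (t : \bar R) : R :=
  match t with
  | r%:E => heaviside (x - r) * psi r
  | _ => 0
  end.

Lemma heaviside_mul_lt (R : realType) (x : R) psi t :
  t < x -> heaviside_mul x psi t%:E = psi t.
Proof. by move=> tx; rewrite /= /heaviside subr_gt0 tx mul1r. Qed.

Lemma heaviside_mul_eq (R : realType) (x : R) psi :
  heaviside_mul x psi x%:E = psi x / 2.
Proof. by rewrite /= /heaviside subrr ltxx eqxx mulrC. Qed.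

Lemma heaviside_mul_gt (R : realType) (x : R) psi t :
  x < t -> heaviside_mul x psi t%:E = 0.
Proof.
move=> xt; rewrite /= /heaviside subr_gt0 subr_eq0 lt_gtF// (lt_eqF xt).
exact: mul0r.
Qed.

(** A real lower end is included: its single point is null for the Lebesgue
    measure, and the integral from [a] to [a] vanishes. *)
Definition lower_itv_bound {R : realType} (A : \bar R) : itv_bound R :=
  if A is a%:E then BLeft a else -oo%O.

(** Integration by parts: the values at [x] and at [A] are the boundary terms.
    At [A = -oo] the boundary term is 0 by definition of [heaviside_mul], which
    is the right value because [psi * f] tends to 0 there. *)
Lemma is_HS_integral_heaviside_mul (R : realType) (A B : \bar R) (x : R)
    (f psi dpsi : R -> R) :
  (A < x%:E < B)%E ->
  (forall t : R, is_derive t 1 psi (dpsi t)) -> continuous dpsi ->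
  (@lebesgue_measure R).-integrable
    [set` Interval (lower_itv_bound A) (BRight x)]
    (EFin \o (fun t => dpsi t * f t)) ->
  (forall z : R, (A < z%:E)%E -> z <= x -> cvg (f t @[t --> z^'-])) ->
  (forall z : R, (A <= z%:E)%E -> z <= x -> cvg (f t @[t --> z^'+])) ->
  (A = -oo%E -> psi t * f t @[t --> -oo] --> 0) ->
  is_HS_integral A B (heaviside_mul x psi) (ext_by_limits f)
    (psi x * ((left_lim f x + right_lim f x) / 2)
     - heaviside_mul x psi A * ext_by_limits f A
     - \int[@lebesgue_measure R]_(t in
         [set` Interval (lower_itv_bound A) (BRight x)]) (dpsi t * f t)).
Proof.
move=> /andP[Ax xB] dpsiP cdpsi intg fl fr psif0.
pose g t := dpsi t * f t.
pose l := lower_itv_bound A.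
pose Phi := indefinite_integral l g.
set L := left_lim f x; set Rx := right_lim f x.
pose V := psi x * ((L + Rx) / 2) - Phi x.
(* The value at x is forced by the tag x, of weight psi x / 2: it exceeds the
   left limit of G at x by psi x / 2 * (f x - L). *)
pose G (t : \bar R) := match t with
  | r%:E => if r < x then psi r * f r - Phi r
            else if r == x then psi x * ((L + f x) / 2) - Phi x else V
  | +oo%E => V
  | -oo%E => 0
  end.
(* Any increasing function bounded near -oo with positive derivative would do in
   place of expR; the jumps on both sides of x and at -oo have size at least 1,
   to absorb the errors that are small without being small compared with the
   length of the interval. *)
pose W (t : \bar R) := match t with
  | r%:E => if r < x then expR r
            else if r == x then expR x + 1 else expR x + 2
  | +oo%E => expR x + 2
  | -oo%E => - 1
  end.
have fxL : f t @[t --> x^'-] --> L by exact: fl.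
have fxR : f t @[t --> x^'+] --> Rx by apply: fr => //; exact: ltW.
have Glt t : t < x -> G t%:E = psi t * f t - Phi t by rewrite /G => ->.
have Gx : G x%:E = psi x * ((L + f x) / 2) - Phi x by rewrite /G ltxx eqxx.
have Ggt t : x < t -> G t%:E = V.
  by move=> xt; rewrite /G lt_gtF// gt_eqF.
have Wlt t : t < x -> W t%:E = expR t by rewrite /W => ->.
have Wx : W x%:E = expR x + 1 by rewrite /W ltxx eqxx.
have Wgt t : x < t -> W t%:E = expR x + 2.
  by move=> xt; rewrite /W lt_gtF// gt_eqF.
have caseA : A = -oo%E \/ exists2 a, A = a%:E & a < x.
  case: A Ax {intg fl fr psif0 Phi V G Glt Gx Ggt l} => [a ax|//|_].
    by right; exists a.
  by left.
have lA (z : R) : (A <= z%:E)%E -> (l <= BRight z)%O.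
  by rewrite /l; case: caseA => [->//|[a -> _]]; rewrite lee_fin /= bnd_simp.
have lA' (z : R) : (A < z%:E)%E -> (l < BLeft z)%O.
  by rewrite /l; case: caseA => [->//|[a -> _]]; rewrite lte_fin /= bnd_simp.
have dpsi_at (z : R) (Fz : set_system R) (FFz : Filter Fz) : Fz --> z ->
    forall e, 0 < e -> \forall v \near Fz,
      `|psi v - psi z - dpsi z * (v - z)| <= e * `|v - z|.
  move=> Fzz e e0; apply: Fzz; exact: is_derive_near.
have right_incr z : (A <= z%:E)%E -> z < x -> forall e, 0 < e ->
    \forall v \near z^'+,
      `|(psi v - psi z) * f v - (Phi v - Phi z)| <= e * `|v - z|.
  move=> Az zx; have /cvg_ex[/= c fc] := fr z Az (ltW zx).
  apply: (@product_increment_near _ _ _ _ _ _ _ (dpsi z) c) => //.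
    exact: dpsi_at (cvg_within _).
  apply: (@indefinite_integral_right _ _ x) => //; first exact: lA.
  by apply: cvgM => //; apply: cvg_at_right_filter; exact: cdpsi.
have left_incr z : (A < z%:E)%E -> z <= x -> forall e, 0 < e ->
    \forall u \near z^'-,
      `|(psi u - psi z) * f u - (Phi u - Phi z)| <= e * `|u - z|.
  move=> Az zx; have /cvg_ex[/= c fc] := fl z Az zx.
  apply: (@product_increment_near _ _ _ _ _ _ _ (dpsi z) c) => //.
    exact: dpsi_at (cvg_within _).
  apply: (@indefinite_integral_left _ _ x) => //; first exact: lA'.
  by apply: cvgM => //; apply: cvg_at_left_filter; exact: cdpsi.
have -> : psi x * ((L + Rx) / 2)
    - heaviside_mul x psi A * ext_by_limits f A - Phi x = G B - G A.
  have -> : G B = V.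
    by case: B xB => // b; rewrite lte_fin => /Ggt.
  suff -> : G A = heaviside_mul x psi A * ext_by_limits f A by rewrite /V; ring.
  case: caseA => [->|[a AE ax]]; first by rewrite mul0r.
  rewrite AE Glt// heaviside_mul_lt//= /Phi /indefinite_integral /l AE /= set_itv1.
  by rewrite Rintegral_set1 subr0.
apply: (is_HS_integral_of_primitive _ _ _ _ _ _ W); first exact: lt_trans xB.
- move=> e e0 z /andP[Az zB].
  case: z Az zB => [z| |] Az zB.
  + apply: near_right_ereal => //.
    have [zx|xz|zx] := ltgtP z x.
    * near=> v.
      have zv : z < v by near: v; exact: nbhs_right_gt.
      have vx : v < x by near: v; exact: nbhs_right_lt.
      rewrite heaviside_mul_lt// !Glt// !Wlt//.
      have -> : psi z * (f v - f z)
          - (psi v * f v - Phi v - (psi z * f z - Phi z))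
        = - ((psi v - psi z) * f v - (Phi v - Phi z)) by ring.
      rewrite normrN (@le_trans _ _ (e * expR z * `|v - z|))//.
        by near: v; apply: right_incr => //; rewrite mulr_gt0// expR_gt0.
      rewrite -mulrA ler_pM2l// gtr0_norm ?subr_gt0//.
      have -> : expR v - expR z = expR z * (expR (v - z) - 1).
        by rewrite mulrBr -expRD mulr1 (addrC z) subrK.
      by rewrite ler_pM2l ?expR_gt0// lerBrDl expR_ge1Dx.
    * near=> v; have zv : z < v by near: v; exact: nbhs_right_gt.
      have xv : x < v by exact: lt_trans zv.
      rewrite heaviside_mul_gt// !Ggt// !Wgt//.
      by rewrite mul0r !subrr mulr0 normr0.
    * rewrite {z Az zB}zx heaviside_mul_eq Gx Wx.
      have : (psi x / 2) * (Rx - f v) @[v --> x^'+] --> (psi x / 2) * (Rx - Rx).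
        by apply: cvgMl_tmp; apply: cvgB => //; exact: cvg_cst.
      rewrite subrr mulr0 => /cvgr0Pnorm_le/(_ _ e0) near_e.
      near=> v; have xv : x < v by near: v; exact: nbhs_right_gt.
      rewrite Ggt// Wgt//= /V.
      have -> : psi x / 2 * (f v - f x)
          - (psi x * ((L + Rx) / 2) - Phi x
             - (psi x * ((L + f x) / 2) - Phi x))
        = - (psi x / 2 * (Rx - f v)) by field.
      have -> : e * (expR x + 2 - (expR x + 1)) = e by ring.
      by rewrite normrN; near: v.
  + by rewrite ltNge leey in zB.
  + have AE : A = -oo%E by apply/eqP; rewrite -leeNy_eq.
    have := psif0 AE; move=> psif.
    have lE : l = -oo%O by rewrite /l AE.
    have : psi t * f t - Phi t @[t --> -oo] --> 0 - 0.
      apply: cvgB => //; rewrite /Phi lE; apply: Rintegral_Ny_cvg0.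
      by have := intg; rewrite -/l lE; exact.
    rewrite subr0 => /cvgr0Pnorm_le/(_ _ e0)[M [_ MP]].
    exists (Num.min M x)%:E.
      by rewrite ltNyr/= (le_lt_trans _ xB)// lee_fin ge_min lexx orbT.
    case=> [v| |]; [|by rewrite andbC ltNge leey|by rewrite ltxx].
    rewrite lte_fin lt_min => /andP[_ /andP[vM vx]].
    rewrite mul0r Wlt// Glt// subr0 sub0r normrN (le_trans (MP v vM))//.
    by rewrite opprK ler_peMr ?(ltW e0)// lerDr expR_ge0.
- move=> e e0 z /andP[Az zB].
  case: z Az zB => [z| |] Az zB.
  + apply: near_left_ereal => //.
    have [zx|xz|zx] := ltgtP z x.
    * have near_e := left_incr _ Az (ltW zx) _ (mulr_gt0 e0 (expR_gt0 (z - 1))).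
      near=> u.
      have uz : u < z by near: u; exact: nbhs_left_lt.
      have zu : z - 1 < u by near: u; apply: nbhs_left_gt; rewrite ltrBlDr ltrDl.
      have ux : u < x by exact: lt_trans zx.
      rewrite heaviside_mul_lt// !Glt// !Wlt//.
      have -> : psi z * (f z - f u)
          - (psi z * f z - Phi z - (psi u * f u - Phi u))
        = (psi u - psi z) * f u - (Phi u - Phi z) by ring.
      rewrite (@le_trans _ _ (e * expR (z - 1) * `|u - z|))//.
        by near: u.
      rewrite -mulrA ler_pM2l// distrC gtr0_norm ?subr_gt0//.
      have -> : expR z - expR u = expR u * (expR (z - u) - 1).
        by rewrite mulrBr -expRD mulr1 (addrC u) subrK.
      rewrite ler_pM ?expR_ge0 ?subr_ge0 ?ler_expR ?(ltW uz) ?(ltW zu)//.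
      by rewrite lerBrDl expR_ge1Dx.
    * near=> u; have xu : x < u by near: u; exact: nbhs_left_gt.
      rewrite heaviside_mul_gt// !Ggt// !Wgt//.
      by rewrite mul0r !subrr mulr0 normr0.
    * rewrite {z Az zB}zx heaviside_mul_eq Gx Wx.
      have e20 : 0 < e / 2 by rewrite divr_gt0.
      have : (psi x / 2) * (f u - L) @[u --> x^'-] --> (psi x / 2) * (L - L).
        by apply: cvgMl_tmp; apply: cvgB => //; exact: cvg_cst.
      rewrite subrr mulr0 => /cvgr0Pnorm_le/(_ _ e20) near_e.
      near=> u; have ux : u < x by near: u; exact: nbhs_left_lt.
      have xu : x - 1 < u by near: u; apply: nbhs_left_gt; rewrite ltrBlDr ltrDl.
      rewrite Glt// Wlt//=.
      have -> : psi x / 2 * (f x - f u)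
          - (psi x * ((L + f x) / 2) - Phi x - (psi u * f u - Phi u)) =
        ((psi u - psi x) * f u - (Phi u - Phi x)) + psi x / 2 * (f u - L) by field.
      apply: (@le_trans _ _ e).
        rewrite (le_trans (ler_normD _ _))// [leRHS]splitr lerD//; last by near: u.
        rewrite (@le_trans _ _ (e / 2 * `|u - x|))//.
          by near: u; exact: left_incr.
        rewrite ler_piMr ?(ltW e20)// distrC gtr0_norm ?subr_gt0//.
        by rewrite lerBlDl -lerBlDr ltW.
      rewrite ler_peMr ?(ltW e0)// addrAC lerDr subr_ge0 ler_expR.
      exact: ltW.
  + exists x%:E; first by rewrite Ax ltry.
    case=> [u| |]; [|by rewrite ltxx andbF|by rewrite ltNge leNye].
    rewrite lte_fin => /andP[xu _].
    by rewrite Ggt// Wgt// mul0r !subrr mulr0 normr0.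
  + by rewrite ltNge leNye in Az.
Unshelve. all: by end_near. Qed.

(** * Regulated functions are integrable *)

(** Around each point, [f] is close to its one-sided limits. At an end of the
    interval one of the limits may fail to exist, but the corresponding side then
    lies outside [[a, b]], and the constant on it is arbitrary. *)
Lemma regulated_near_approx (R : realType) (a b : R) (f : R -> R) (e : R) :
  regulated a%:E b%:E f -> 0 < e -> forall z, a <= z <= b ->
  exists l c r, 0 < r /\ forall t, a <= t <= b -> `|z - t| < r ->
    (t < z -> `|f t - l| <= e) /\ (z < t -> `|f t - c| <= e).
Proof.
move=> [fl fr _ _] e0 z /andP[az zb].
have [l nearl] : exists l, \forall t \near z^'-, a <= t -> `|f t - l| <= e.
  move: az; rewrite le_eqVlt => /predU1P[<-|az].
    exists 0; near=> t; rewrite leNgt.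
    have -> // : t < a by near: t; exact: nbhs_left_lt.
  have /cvg_ex[/= l /cvgrPdist_le/(_ e e0) fzl] : cvg (f t @[t --> z^'-]).
    by apply: fl; rewrite lte_fin lee_fin az.
  by exists l; apply: filterS fzl => t + _; rewrite distrC.
have [c nearc] : exists c, \forall t \near z^'+, t <= b -> `|f t - c| <= e.
  move: zb; rewrite le_eqVlt => /predU1P[->|zb].
    exists 0; near=> t; rewrite leNgt.
    have -> // : b < t by near: t; exact: nbhs_right_gt.
  have /cvg_ex[/= c /cvgrPdist_le/(_ e e0) fzc] : cvg (f t @[t --> z^'+]).
    by apply: fr; rewrite lte_fin lee_fin az.
  by exists c; apply: filterS fzc => t + _; rewrite distrC.
move: nearl nearc; rewrite !near_withinE.
move=> /nbhs_ballP[r1/= r10 r1P] /nbhs_ballP[r2/= r20 r2P].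
exists l, c, (Num.min r1 r2); rewrite lt_min r10 r20; split => // t /andP[ta tb].
rewrite lt_min => /andP[tr1 tr2].
by split => tz; [exact: r1P|exact: r2P].
Unshelve. all: by end_near. Qed.

(** By compactness finitely many of the neighbourhoods of the previous lemma
    cover [[a, b]]; the local step functions are glued by induction on the list
    of their centres. *)
Lemma regulated_approx (R : realType) (a b : R) (f : R -> R) (e : R) :
  regulated a%:E b%:E f -> 0 < e ->
  exists (h : R -> R) (M : R), [/\ measurable_fun setT h,
    forall t, `|h t| <= M & forall t, a <= t <= b -> `|f t - h t| <= e].
Proof.
move=> regf e0.
have /choice[r rP] : forall z, exists r : R, 0 < r /\ (a <= z <= b ->
    exists l c, forall t, a <= t <= b -> `|z - t| < r ->
    (t < z -> `|f t - l| <= e) /\ (z < t -> `|f t - c| <= e)).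
  move=> z; have [zab|] := boolP (a <= z <= b); last by exists 1.
  have [l [c [r [r0 rP]]]] := regulated_near_approx _ _ _ _ _ regf e0 z zab.
  by exists r; split=> // _; exists l, c.
have := @segment_compact R a b; rewrite compact_cover.
move=> /(_ _ `[a, b]%classic (fun z => ball z (r z))).
case=> [z _|z zab|D Dab abD].
- exact: ball_open.
- by exists z => //; apply: ballxx; case: (rP z).
suff [h [M [mh hM hP]]] : exists (h : R -> R) (M : R),
    [/\ measurable_fun setT h, forall t, `|h t| <= M &
    forall t, a <= t <= b ->
      (exists2 z, z \in (finmap.enum_fset D) & `|z - t| < r z) ->
      `|f t - h t| <= e].
  exists h, M; split => // t tab; apply: hP => //.
  have [|z /= zD zt] := abD t; first by rewrite /= in_itv.
  by exists z.
have : forall z, z \in (finmap.enum_fset D) -> a <= z <= b.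
  by move=> z zD; have := Dab z zD; rewrite inE/= in_itv.
elim: (finmap.enum_fset D) => [_|z s IH sab].
  by exists (cst 0), 0; split => // [t|t _ []//]; rewrite normr0.
have [h [M [mh hM hP]]] := IH (fun y ys => sab y (@mem_behead _ (z :: s) y ys)).
have [r0 /(_ (sab _ (mem_head _ _)))[l [c lcP]]] := rP z.
pose k t := if t < z then l else if z < t then c else f z.
exists (fun t => if `|z - t| < r z then k t else h t),
  (`|l| + `|c| + `|f z| + `|M|).
split.
- apply: measurable_fun_ifT => //.
    apply: measurable_fun_ltr => //; apply: measurableT_comp => //.
    exact: measurable_funB.
  apply: measurable_fun_ifT => //; first exact: measurable_fun_ltr.
  by apply: measurable_fun_ifT => //; exact: measurable_fun_ltr.
- move=> t; have [_|_] := ifPn.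
    rewrite /k; have := (normr_ge0 l, normr_ge0 c, normr_ge0 (f z), normr_ge0 M).
    by case=> -[[? ?] ?] ?; case: ifP => _; [|case: ifP => _]; lra.
  by rewrite (le_trans (hM t))// (le_trans (ler_norm M))// lerDr !addr_ge0.
- move=> t tab [y]; have [tz _ _|tz] := ifPn.
    have [tl tc] := lcP t tab tz.
    rewrite /k; have [/tl//|/tc//|->] := ltgtP t z.
    by rewrite subrr normr0 ltW.
  rewrite inE => /predU1P[->|ys yt]; first by rewrite (negbTE tz).
  by apply: hP => //; exists y.
Qed.

(** Uniform approximation within 1 gives the boundedness, and uniform
    approximation within 1 / (n + 1) the measurability. *)
Lemma regulated_integrable (R : realType) (a b : R) (f : R -> R) :
  regulated a%:E b%:E f -> (@lebesgue_measure R).-integrable `[a, b] (EFin \o f).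
Proof.
move=> regf.
apply: measurable_bounded_integrable => //.
- rewrite /= lebesgue_measure_itv/=; case: ifP => // _; exact: ltry.
- have /choice[h hP] : forall n : nat, exists h : R -> R,
      measurable_fun setT h /\ forall t, a <= t <= b -> `|f t - h t| <= n.+1%:R^-1.
    move=> n; have [|h [_ [mh _ hP]]] := regulated_approx _ _ _ _ n.+1%:R^-1 regf.
      by rewrite invr_gt0.
    by exists h.
  apply: (@measurable_fun_cvg _ _ _ _ h) => [n|t].
    by apply: measurable_funTS; case: (hP n).
  rewrite /= in_itv/= => tab; apply/cvgrPdist_le => e e0.
  near=> n; apply: le_trans ((hP n).2 t tab) _.
  by apply: ltW; near: n; exact: (near_infty_natSinv_lt (PosNum e0)).
- have [h [M [_ hM hP]]] := regulated_approx _ _ _ _ _ regf ltr01.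
  exists (M + 1); split; first exact: num_real.
  move=> y My t; rewrite /= in_itv/= => tab.
  have -> : f t = (f t - h t) + h t by rewrite subrK.
  rewrite (le_trans (ler_normD _ _))// (le_trans _ (ltW My))// addrC lerD//.
  exact: hP.
Unshelve. all: by end_near. Qed.

(** * The exponential kernel *)

(** With [omega = al + i be], [exp_cos] and [exp_sin] are the real and imaginary
    parts of [exp (i omega (x - t))]. *)
Definition exp_cos {R : realType} (al be x t : R) : R :=
  expR (- be * (x - t)) * cos (al * (x - t)).

Definition exp_sin {R : realType} (al be x t : R) : R :=
  expR (- be * (x - t)) * sin (al * (x - t)).

Lemma is_derive_exp_cos (R : realType) (al be x t : R) :
  is_derive t 1 (exp_cos al be x)
    (be * exp_cos al be x t + al * exp_sin al be x t).
Proof.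
rewrite /exp_cos /exp_sin; apply: is_derive_eq.
rewrite /GRing.scale/=; ring.
Qed.

Lemma is_derive_exp_sin (R : realType) (al be x t : R) :
  is_derive t 1 (exp_sin al be x)
    (be * exp_sin al be x t - al * exp_cos al be x t).
Proof.
rewrite /exp_cos /exp_sin; apply: is_derive_eq.
rewrite /GRing.scale/=; ring.
Qed.

Lemma continuous_exp_cos (R : realType) (al be x : R) :
  continuous (exp_cos al be x).
Proof.
move=> t; apply: differentiable_continuous; apply/derivable1_diffP.
by have [] := is_derive_exp_cos _ al be x t.
Qed.

Lemma continuous_exp_sin (R : realType) (al be x : R) :
  continuous (exp_sin al be x).
Proof.
move=> t; apply: differentiable_continuous; apply/derivable1_diffP.
by have [] := is_derive_exp_sin _ al be x t.
Qed.

Lemma norm_exp_cos_le (R : realType) (al be x t : R) :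
  `|exp_cos al be x t| <= expR (- be * (x - t)).
Proof.
rewrite normrM ger0_norm ?expR_ge0// ler_piMr ?expR_ge0//.
by rewrite ler_norml cos_geN1 cos_le1.
Qed.

Lemma norm_exp_sin_le (R : realType) (al be x t : R) :
  `|exp_sin al be x t| <= expR (- be * (x - t)).
Proof.
rewrite normrM ger0_norm ?expR_ge0// ler_piMr ?expR_ge0//.
by rewrite ler_norml sin_geN1 sin_le1.
Qed.

Lemma Re_heaviside_exp (R : realType) (omega : R[i]) (x : R) (t : \bar R) :
  complex.Re (heaviside_exp omega x t) =
  heaviside_mul x (exp_cos (complex.Re omega) (complex.Im omega) x) t.
Proof.
case: omega => al be; case: t => [t| |] //=.
rewrite /exp_cos !(mul0r, mul1r, mulr0, subr0, sub0r, add0r, addr0) mulNr.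
by [].
Qed.

Lemma Im_heaviside_exp (R : realType) (omega : R[i]) (x : R) (t : \bar R) :
  complex.Im (heaviside_exp omega x t) =
  heaviside_mul x (exp_sin (complex.Re omega) (complex.Im omega) x) t.
Proof.
case: omega => al be; case: t => [t| |] //=.
rewrite /exp_sin !(mul0r, mul1r, mulr0, subr0, sub0r, add0r, addr0) mulNr.
by [].
Qed.

Lemma measurable_heaviside (R : realType) (x : R) :
  measurable_fun setT (fun t : R => heaviside (x - t)).
Proof.
have -> : (fun t : R => heaviside (x - t)) =
    (fun t => if t < x then 1 else if x < t then 0 else 2^-1).
  apply/funext => t; rewrite /heaviside subr_gt0 subr_eq0.
  by have [| |] := ltgtP t x.
apply: measurable_fun_ifT => //; first exact: measurable_fun_ltr.
by apply: measurable_fun_ifT => //; exact: measurable_fun_ltr.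
Qed.

Lemma norm_heaviside_le1 (R : realType) (u : R) : `|heaviside u| <= 1.
Proof.
rewrite /heaviside; case: ifP => _; first by rewrite normr1.
case: ifP => _; last by rewrite normr0.
by rewrite ger0_norm ?invr_ge0// invf_le1 ?ler1n.
Qed.

Lemma integrable_mul_bounded (R : realType) (d : measure_display)
    (T : measurableType d) (mu : {measure set T -> \bar R}) (D : set T)
    (f h : T -> R) (M : R) :
  measurable D -> mu.-integrable D (EFin \o f) ->
  measurable_fun D h -> (forall t, D t -> `|h t| <= M) ->
  mu.-integrable D (EFin \o (fun t => h t * f t)).
Proof.
move=> mD intf mh hM.
have bh : [bounded h t | t in D].
  exists M; split; first exact: num_real.
  by move=> y My t Dt; rewrite /= (le_trans (hM t Dt))// ltW.
exact: (integrableMr mD mh bh intf).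
Qed.

Lemma mem_lower_itv (R : realType) (A : \bar R) (x t : R) : (A < x%:E)%E ->
  [set` Interval (lower_itv_bound A) (BRight x)] t <->
  (A <= t%:E)%E && (t <= x).
Proof.
case: A => [a|//|] _; rewrite /= in_itv/= ?lee_fin//.
by rewrite leNye.
Qed.

(** * The mixed integral *)

(** The two integrands differ in [D] only right of [x], where the first one
    vanishes and where nothing is known of [f], and at the null point [x]. *)
Lemma heaviside_mul_integral (R : realType) (A B : \bar R) (x : R)
    (f psi : R -> R) (M : R) :
  let J := [set` Interval (lower_itv_bound A) (BRight x)] in
  let D := [set t : R | (A <= t%:E <= B)%E] in
  let k := fun t => heaviside_mul x psi t%:E * f t in
  (A < x%:E < B)%E ->
  (@lebesgue_measure R).-integrable J (EFin \o f) ->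
  continuous psi -> (forall t, J t -> `|psi t| <= M) ->
  (@lebesgue_measure R).-integrable D (EFin \o k) /\
  \int[@lebesgue_measure R]_(t in D) k t =
  \int[@lebesgue_measure R]_(t in J) (psi t * f t).
Proof.
move=> J D k /andP[Ax xB] intf cpsi psiM.
have mJ : measurable (J : set (measurableTypeR R)) by exact: measurable_itv.
have mpsi : measurable_fun (setT : set (measurableTypeR R)) psi.
  exact: continuous_measurable_fun.
have intpf : (@lebesgue_measure R).-integrable J
    (EFin \o (fun t => psi t * f t)).
  apply: (integrable_mul_bounded _ _ _ _ _ _ _ M) => //.
  exact: measurable_funTS.
have intk : (@lebesgue_measure R).-integrable J (EFin \o k).
  apply: (integrable_mul_bounded _ _ _ _ _ _ _ M) => //.
    apply: measurable_funTS; apply: measurable_funM => //.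
    exact: measurable_heaviside.
  move=> t Jt; rewrite /= normrM -[leRHS]mul1r ler_pM//.
    exact: norm_heaviside_le1.
  exact: psiM.
have JE t : J t <-> (A <= t%:E)%E && (t <= x) := mem_lower_itv _ _ _ t Ax.
have kDJ : k \_ D = k \_ J.
  apply/funext => t; rewrite !patchE.
  have [tx|xt] := leP t x.
    congr (if _ then _ else _); apply/idP/idP; rewrite !inE.
      by move=> /andP[At _]; apply/JE; rewrite At.
    by move=> /JE/andP[At _]; rewrite /D/= At/= (le_trans _ (ltW xB))// lee_fin.
  by rewrite /k heaviside_mul_gt// mul0r; do 2 case: ifP => //.
have mD : measurable (D : set (measurableTypeR R)).
  rewrite (_ : D = setT `&` EFin @^-1` `[A, B]%classic); last first.
    by rewrite setTI; apply/seteqP; split => t /=; rewrite in_itv.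
  by apply: EFin_measurable => //; exact: emeasurable_itv.
split.
  apply/(integrable_mkcond _ mD); rewrite restrict_EFin kDJ -restrict_EFin.
  exact/(integrable_mkcond _ mJ).
rewrite Rintegral_mkcond kDJ -Rintegral_mkcond /J.
have subJ : [set` Interval (lower_itv_bound A) (BLeft x)] `<=` J.
  by apply: subset_itvl; rewrite bnd_simp.
rewrite -!Rintegral_itv_bndo_bndc; last 2 first.
- exact: integrableS intpf.
- exact: integrableS intk.
apply: eq_Rintegral => t; rewrite inE => /= tx.
rewrite /k heaviside_mul_lt//.
by move: tx; rewrite itv_boundlr => /andP[_]; rewrite bnd_simp.
Qed.

(** This is where a positive imaginary part of omega matters: the kernel decays
    exponentially at -oo. *)
Lemma exp_kernel_cvg0 (R : realType) (be x c : R) (h f : R -> R) : 0 < be ->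
  (forall t, `|h t| <= expR (- be * (x - t))) ->
  f t @[t --> -oo] --> c -> h t * f t @[t --> -oo] --> 0.
Proof.
move=> be0 hP fc; rewrite -(mul0r c); apply: cvgM => //.
apply/cvgr0Pnorm_lt => e e0; exists (x + ln e / be); split; first exact: num_real.
move=> t tx; rewrite (le_lt_trans (hP t))//.
rewrite -[ltRHS]lnK ?posrE// ltr_expR mulNr -mulrN opprB mulrC -ltr_pdivlMr//.
by rewrite ltrBlDl.
Qed.

(** Integration by parts for the real part [p] and the imaginary part [q] of the
    kernel produces the integrals of [p' f] and [q' f]. Since [p + i q] has
    derivative [- i omega (p + i q)], these are the real and imaginary parts of
    the term [- i omega] times the Lebesgue integral, and only the boundary terms
    remain, with [p x = 1] and [q x = 0]. *)
Lemma is_mixed_integral_heaviside_exp (R : realType) (A B : \bar R) (x : R)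
    (omega : R[i]) (f : R -> R) (M : R) :
  (A < x%:E < B)%E ->
  (@lebesgue_measure R).-integrable
    [set` Interval (lower_itv_bound A) (BRight x)] (EFin \o f) ->
  (forall z : R, (A < z%:E)%E -> z <= x -> cvg (f t @[t --> z^'-])) ->
  (forall z : R, (A <= z%:E)%E -> z <= x -> cvg (f t @[t --> z^'+])) ->
  (A = -oo%E -> 0 < complex.Im omega /\ cvg (f t @[t --> -oo])) ->
  (forall t : R, (A <= t%:E)%E -> t <= x ->
     expR (- complex.Im omega * (x - t)) <= M) ->
  is_mixed_integral A B omega (heaviside_exp omega x) f
    (((left_lim f x + right_lim f x) / 2)%:C%C
     - (ext_by_limits f A)%:C%C * heaviside_exp omega x A).
Proof.
move=> AxB intf fl fr fNy expM.
set al := complex.Re omega; set be := complex.Im omega.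
set p := exp_cos al be x; set q := exp_sin al be x.
set J := [set` Interval (lower_itv_bound A) (BRight x)].
have JA t : J t -> (A <= t%:E)%E /\ t <= x.
  by case/andP: AxB => Ax _ /(mem_lower_itv _ _ _ _ Ax)/andP.
have pM t : J t -> `|p t| <= M.
  by move=> /JA[At tx]; rewrite (le_trans (norm_exp_cos_le _ _ _ _ _))// expM.
have qM t : J t -> `|q t| <= M.
  by move=> /JA[At tx]; rewrite (le_trans (norm_exp_sin_le _ _ _ _ _))// expM.
have cp : continuous p by exact: continuous_exp_cos.
have cq : continuous q by exact: continuous_exp_sin.
have mJ : measurable (J : set (measurableTypeR R)) by exact: measurable_itv.
have ipf : (@lebesgue_measure R).-integrable J (EFin \o (fun t => p t * f t)).
  apply: (integrable_mul_bounded _ _ _ _ _ _ _ M) => //; apply: measurable_funTS.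
  exact: continuous_measurable_fun.
have iqf : (@lebesgue_measure R).-integrable J (EFin \o (fun t => q t * f t)).
  apply: (integrable_mul_bounded _ _ _ _ _ _ _ M) => //; apply: measurable_funTS.
  exact: continuous_measurable_fun.
pose P := \int[@lebesgue_measure R]_(t in J) (p t * f t).
pose Q := \int[@lebesgue_measure R]_(t in J) (q t * f t).
have comb c d : (@lebesgue_measure R).-integrable J
    (EFin \o (fun t => (c * p t + d * q t) * f t)) /\
  \int[@lebesgue_measure R]_(t in J) ((c * p t + d * q t) * f t) = c * P + d * Q.
  have icp : (@lebesgue_measure R).-integrable J
      (EFin \o (fun t => c * (p t * f t))).
    by apply: (integrable_mul_bounded _ _ _ _ _ _ (cst c) `|c|).
  have idq : (@lebesgue_measure R).-integrable J
      (EFin \o (fun t => d * (q t * f t))).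
    by apply: (integrable_mul_bounded _ _ _ _ _ _ (cst d) `|d|).
  have eqf : (fun t => (c * p t + d * q t) * f t) =
      (fun t => c * (p t * f t) + d * (q t * f t)).
    by apply/funext => t; ring.
  rewrite eqf; split; first by apply: (integrableD _ icp idq).
  by rewrite RintegralD// !RintegralZl.
have [intp Ep] := heaviside_mul_integral _ _ B _ _ _ _ AxB intf cp pM.
have [intq Eq] := heaviside_mul_integral _ _ B _ _ _ _ AxB intf cq qM.
have Nyp : A = -oo%E -> p t * f t @[t --> -oo] --> 0.
  move=> /fNy[be0 /cvg_ex[/= c fc]].
  exact: (exp_kernel_cvg0 _ be x c p f be0 (norm_exp_cos_le _ al be x) fc).
have Nyq : A = -oo%E -> q t * f t @[t --> -oo] --> 0.
  move=> /fNy[be0 /cvg_ex[/= c fc]].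
  exact: (exp_kernel_cvg0 _ be x c q f be0 (norm_exp_sin_le _ al be x) fc).
have HSp := is_HS_integral_heaviside_mul _ A B x f p
  (fun t => be * p t + al * q t) AxB (is_derive_exp_cos _ al be x) _
  (comb be al).1 fl fr Nyp.
have HSq := is_HS_integral_heaviside_mul _ A B x f q
  (fun t => - al * p t + be * q t) AxB _ _ (comb (- al) be).1 fl fr Nyq.
rewrite (comb _ _).2 in HSp; rewrite (comb _ _).2 in HSq.
have px : p x = 1 by rewrite /p /exp_cos subrr !mulr0 expR0 cos0 mulr1.
have qx : q x = 0 by rewrite /q /exp_sin subrr !mulr0 sin0 mulr0.
have ReE : (fun t => complex.Re (heaviside_exp omega x t%:E * (f t)%:C%C)) =
    (fun t => heaviside_mul x p t%:E * f t).
  apply/funext => t; rewrite -Re_heaviside_exp; case: (heaviside_exp _ _ _) => u v /=.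
  by rewrite mulr0 subr0.
have ImE : (fun t => complex.Im (heaviside_exp omega x t%:E * (f t)%:C%C)) =
    (fun t => heaviside_mul x q t%:E * f t).
  apply/funext => t; rewrite -Im_heaviside_exp; case: (heaviside_exp _ _ _) => u v /=.
  by rewrite mulr0 add0r.
eexists (Complex _ _); split.
- split => /=.
    have -> : (fun t => complex.Re (heaviside_exp omega x t)) =
        heaviside_mul x p.
      by apply/funext => t; exact: Re_heaviside_exp.
    apply: HSp => t.
    apply: cvgD; apply: cvgM; [exact: cvg_cst|exact: cp|exact: cvg_cst|exact: cq].
  have -> : (fun t => complex.Im (heaviside_exp omega x t)) = heaviside_mul x q.
    by apply/funext => t; exact: Im_heaviside_exp.
  apply: HSq => t.
    by apply: is_derive_eq (is_derive_exp_sin _ al be x t) _; rewrite mulNr addrC.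
  apply: cvgD; apply: cvgM; [exact: cvg_cst|exact: cp|exact: cvg_cst|exact: cq].
- by rewrite /integrableC ReE ImE.
- rewrite /integralC ReE ImE.
  rewrite Ep Eq -/P -/Q px qx.
  have -> : heaviside_exp omega x A =
      Complex (heaviside_mul x p A) (heaviside_mul x q A).
    by rewrite -Re_heaviside_exp -Im_heaviside_exp; case: heaviside_exp.
  have -> : omega = Complex al be by rewrite /al /be; case: (omega).
  by apply/eqP; rewrite eq_complex/=; apply/andP; split; apply/eqP; ring.
Qed.

Theorem lemma2p2 (R : realType) (a x b : R) (hax : a < x) (hxb : x < b) :
  (forall (omega : R[i]) (f : R -> R),
     0 < complex.Im omega ->
     (@lebesgue_measure R).-integrable [set t : R | t <= b] (EFin \o f) ->
     regulated -oo%E b%:E f ->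
     is_mixed_integral -oo%E +oo%E omega (heaviside_exp omega x) f
       ((left_lim f x + right_lim f x) / 2)%:C%C)
  /\
  (forall (omega : R[i]) (f : R -> R),
     regulated a%:E b%:E f ->
     exists2 v : R[i],
       is_mixed_integral a%:E b%:E omega (heaviside_exp omega x) f v &
       ((left_lim f x + right_lim f x) / 2)%:C%C
         = v + (f a)%:C%C * cexp ('i%C * omega * (x - a)%:C%C)).
Proof.
split=> [omega f om0 intf [fl fr fNy _]|omega f regf].
- rewrite -[X in is_mixed_integral _ _ _ _ _ X]subr0.
  rewrite -[in X in _ - X](mulr0 (ext_by_limits f -oo%E)%:C%C).
  apply: (is_mixed_integral_heaviside_exp _ _ _ _ _ _ 1).
  + by rewrite ltNyr ltry.
  + apply: integrableS intf => //=.
      by rewrite -set_itvNyc.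
    by move=> t /=; rewrite in_itv/= => tx; rewrite (le_trans tx)// ltW.
  + by move=> z _ zx; apply: fl; rewrite ltNyr lee_fin (le_trans zx)// ltW.
  + by move=> z _ zx; apply: fr; rewrite leNye lte_fin (le_lt_trans zx).
  + by move=> _; split => //; exact: fNy.
  + by move=> t _ tx; rewrite expR_le1 mulNr oppr_le0 mulr_ge0 ?subr_ge0// ltW.
- have [fl fr _ _] := regf.
  eexists.
    apply: (is_mixed_integral_heaviside_exp _ _ _ _ _ _
              (expR (`|complex.Im omega| * (x - a)))).
    + by rewrite !lte_fin hax.
    + apply: integrableS (regulated_integrable _ _ _ _ regf) => //=.
      by apply: subset_itvl; rewrite bnd_simp ltW.
    + move=> z az zx; apply: fl; rewrite az lee_fin (le_trans zx)//.
      exact: ltW.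
    + by move=> z az zx; apply: fr; rewrite az lte_fin (le_lt_trans zx).
    + by [].
    + move=> t; rewrite lee_fin ler_expR => at_ tx.
      rewrite (@le_trans _ _ (`|complex.Im omega| * (x - t)))//.
        by rewrite ler_wpM2r ?subr_ge0// -normrN ler_norm.
      by rewrite ler_wpM2l// lerD2l lerN2.
  rewrite /= /heaviside subr_gt0 hax.
  by rewrite mul1r subrK.
Qed.
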